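(* Let $g,\ell>0$ be real numbers, put $\omega=\sqrt{g/\ell}$ and $T=2\pi/\omega=2\pi\sqrt{\ell/g}$, and let $\lambda\in{}^{\ast}\mathbb{R}$ be a positive infinitesimal such that $T/\lambda$ is a hypernatural number. Let $F:{}^{\ast}\mathbb{C}\to{}^{\ast}\mathbb{C}$ be the pendulum prevector field, $F(z)=z+\delta_F(z)$ with $\delta_F(x+iy)=\lambda\omega\,y-i\lambda\omega\sin x$. Then the period of infinitesimal oscillations of the pendulum is independent of their amplitude, in the following sense: modulo the choice of a representative in the adequality class of $F$, the hyperreal walk is periodic with period $T$, whatever the infinitesimal amplitude. Explicitly, the prevector field $H:{}^{\ast}\mathbb{C}\to{}^{\ast}\mathbb{C}$, $H(z)=e^{-i\lambda\omega}z$, with displacement $\delta_H(z)=H(z)-z$, satisfies: (1) $\delta_H(z)$ and $\delta_F(z)$ are adequal for every infinitesimal $z\in{}^{\ast}\mathbb{C}$ (that is, $H$ represents the adequality class of $F$ for infinitesimal oscillations); (2) for every positive infinitesimal amplitude $a\in{}^{\ast}\mathbb{R}$, the hyperreal walk $t\mapsto H_t(a)$ starting at $a+0i$ is periodic with period $T=2\pi\sqrt{\ell/g}$; in particular the period does not depend on $a$.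
   Context: The setting is Robinson's nonstandard analysis: ${}^{\ast}\mathbb{R}\supseteq\mathbb{R}$ is a hyperreal extension satisfying the transfer principle, ${}^{\ast}\mathbb{C}={}^{\ast}\mathbb{R}+i\,{}^{\ast}\mathbb{R}$, and ${}^{\ast}\mathbb{N}$ denotes the hypernatural numbers. Standard functions such as $\sin$ and $\exp$ are used through their natural extensions. Points of ${}^{\ast}\mathbb{C}$ are written $z=x+iy$ with $x,y\in{}^{\ast}\mathbb{R}$. A positive hyperreal is infinitesimal if it is smaller than every positive real; $z\in{}^{\ast}\mathbb{C}$ is infinitesimal if $z=0$ or $|z|$ is a positive infinitesimal. Write $z\approx w$ if $z-w$ is infinitesimal. Pendulum: the equation of motion for the angle $x$ with the downward vertical is $\ddot x=-\frac{g}{\ell}\sin x$ with $x(0)=a$, $\dot x(0)=0$, where $a$ is the amplitude, $g$ is the constant of gravity and $\ell$ is the length of the rod. It is rewritten as the first-order system $\dot x=\omega y$, $\dot y=-\omega\sin x$, with $\omega=\sqrt{g/\ell}$ and initial condition $(x,y)=(a,0)$, identified with $a+0i\in{}^{\ast}\mathbb{C}$. ''Infinitesimal oscillations'' means that $a$ is infinitesimal. Prevector field: an internal function $F:{}^{\ast}\mathbb{C}\to{}^{\ast}\mathbb{C}$ written as $F(z)=z+\delta_F(z)$, where $\delta_F$ is the displacement. A classical vector field $V$ gives the displacement $\delta_F(z)=\lambda V(z)$, where $\lambda$ is a fixed positive infinitesimal. Hyperreal walk: for $t=N\lambda$ with $N\in{}^{\ast}\mathbb{N}$, $F_t(z)=F^{\circ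 N}(z)$, where $F^{\circ N}$ is the (internal) $N$-fold composition of $F$ with itself. The walk is Euler's method with infinitesimal step $\lambda$, and is taken as the solution of the differential equation. Adequality: $z,w\in{}^{\ast}\mathbb{C}$ are adequal if either $z=w=0$, or $w\neq 0$ and $\frac{z}{w}\approx 1$. Two prevector fields are in the same adequality class (for infinitesimal oscillations) if their displacements are adequal at every infinitesimal $z$. Period: a walk $t\mapsto H_t(a)$, with $t$ ranging over the hypernatural multiples of $\lambda$ (including $0$), is periodic with period $T$ if $T$ is the least positive hypernatural multiple of $\lambda$ such that $H_{t+T}(a)=H_t(a)$ for all such $t$. *)

(* Defs.v *)
From Stdlib Require Import Reals List ClassicalEpsilon.
From Coquelicot Require Import Coquelicot.

Set Implicit Arguments.
Unset Strict Implicit.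
Unset Printing Implicit Defensive.

(** * Many-sorted first-order formulas

    The sorts are all types (in particular [R], [nat], [C] and function types
    such as [C -> C]), and every element, function and predicate over them is
    available as a symbol.  A context lists the sorts of the free variables. *)

Inductive var : list Type -> Type -> Type :=
| VZ : forall (G : list Type) (X : Type), var (X :: G) X
| VS : forall (G : list Type) (X Y : Type), var G X -> var (Y :: G) X.

Inductive term (G : list Type) : Type -> Type :=
| Var : forall X : Type, var G X -> term G X
| Cst : forall X : Type, X -> term G X
| Pair : forall X Y : Type, term G X -> term G Y -> term G (X * Y)
| App : forall X Y : Type, (X -> Y) -> term G X -> term G Y.

Inductive formula : list Type -> Type :=
| FEq : forall (G : list Type) (X : Type), term G X -> term G X -> formula G
| FPred : forall (G : list Type) (X : Type),
    (X -> Prop) -> term G X -> formula G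
| FBot : forall G : list Type, formula G
| FAnd : forall G : list Type, formula G -> formula G -> formula G
| FOr : forall G : list Type, formula G -> formula G -> formula G
| FImp : forall G : list Type, formula G -> formula G -> formula G
| FAll : forall (G : list Type) (X : Type), formula (X :: G) -> formula G
| FEx : forall (G : list Type) (X : Type), formula (X :: G) -> formula G.

Record interpretation := Interpretation {
  carrier : Type -> Type;
  elt : forall X : Type, X -> carrier X;
  pair_ext : forall X Y : Type, carrier X -> carrier Y -> carrier (X * Y);
  fun_ext : forall X Y : Type, (X -> Y) -> carrier X -> carrier Y;
  pred_ext : forall X : Type, (X -> Prop) -> carrier X -> Prop
}.

Fixpoint env (M : interpretation) (G : list Type) : Type :=
  match G with
  | nil => unit
  | X :: G' => (carrier M X * env M G')%type
  end.

Fixpoint lookup (M : interpretation) (G : list Type) (X : Type)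
    (v : var G X) : env M G -> carrier M X :=
  match v in var G0 X0 return env M G0 -> carrier M X0 with
  | VZ _ _ => fun e => fst e
  | VS _ _ _ v' => fun e => lookup v' (snd e)
  end.

Fixpoint eval (M : interpretation) (G : list Type) (e : env M G) (X : Type)
    (t : term G X) : carrier M X :=
  match t in term _ X0 return carrier M X0 with
  | Var _ v => lookup v e
  | Cst _ c => elt M c
  | Pair _ _ t1 t2 => pair_ext (eval e t1) (eval e t2)
  | App _ _ f t' => fun_ext f (eval e t')
  end.

Fixpoint holds (M : interpretation) (G : list Type) (phi : formula G) :
    env M G -> Prop :=
  match phi in formula G0 return env M G0 -> Prop with
  | FEq _ _ t u => fun e => eval e t = eval e u
  | FPred _ _ P t => fun e => pred_ext P (eval e t)
  | FBot _ => fun _ => False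
  | FAnd _ p q => fun e => holds p e /\ holds q e
  | FOr _ p q => fun e => holds p e \/ holds q e
  | FImp _ p q => fun e => holds p e -> holds q e
  | FAll _ X p => fun e => forall x : carrier M X, holds p (x, e)
  | FEx _ X p => fun e => exists x : carrier M X, holds p (x, e)
  end.

Definition standard : interpretation :=
  @Interpretation (fun X => X) (fun _ x => x) (fun _ _ x y => (x, y))
    (fun _ _ f x => f x) (fun _ P x => P x).

Definition transfer_principle (M : interpretation) : Prop :=
  forall phi : formula nil,
    holds (M := standard) phi tt <-> holds (M := M) phi tt.

(** An extension [*X] of every set [X], satisfying transfer.  The elements of
    [*(X -> Y)] are the internal functions from [*X] to [*Y]. *)
Record extension := Extension {
  interp :> interpretation;
  transfer : transfer_principle interp
}.

Definition star (U : extension) (X : Type) : Type := carrier U X.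

Definition std (U : extension) (X : Type) (x : X) : star U X := elt U x.

Definition ext1 (U : extension) (X Y : Type) (f : X -> Y) (x : star U X) :
    star U Y := fun_ext f x.

Definition ext2 (U : extension) (X Y Z : Type) (f : X -> Y -> Z)
    (x : star U X) (y : star U Y) : star U Z :=
  fun_ext (fun p => f (fst p) (snd p)) (pair_ext x y).

Definition rel2 (U : extension) (X Y : Type) (P : X -> Y -> Prop)
    (x : star U X) (y : star U Y) : Prop :=
  pred_ext (fun p => P (fst p) (snd p)) (pair_ext x y).

Definition app (U : extension) (X Y : Type) (f : star U (X -> Y))
    (x : star U X) : star U Y := ext2 (fun (g : X -> Y) a => g a) f x.

(** * Hyperreal, hypercomplex and hypernatural numbers *)

Definition hreal (U : extension) : Type := star U R.
Definition hcomplex (U : extension) : Type := star U C.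
Definition hnat (U : extension) : Type := star U nat.

Definition hadd (U : extension) : hreal U -> hreal U -> hreal U := ext2 Rplus.
Definition hopp (U : extension) : hreal U -> hreal U := ext1 Ropp.
Definition hmul (U : extension) : hreal U -> hreal U -> hreal U := ext2 Rmult.
Definition hdiv (U : extension) : hreal U -> hreal U -> hreal U := ext2 Rdiv.
Definition hlt (U : extension) : hreal U -> hreal U -> Prop := rel2 Rlt.
Definition hle (U : extension) : hreal U -> hreal U -> Prop := rel2 Rle.
Definition hsin (U : extension) : hreal U -> hreal U := ext1 sin.
Definition hINR (U : extension) : hnat U -> hreal U := ext1 INR.

(** [x + i y]; recall that Coquelicot's [C] is [R * R]. *)
Definition hC (U : extension) (x y : hreal U) : hcomplex U := pair_ext x y.
Definition hCadd (U : extension) : hcomplex U -> hcomplex U -> hcomplex U :=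
  ext2 Cplus.
Definition hCsub (U : extension) : hcomplex U -> hcomplex U -> hcomplex U :=
  ext2 Cminus.
Definition hCmul (U : extension) : hcomplex U -> hcomplex U -> hcomplex U :=
  ext2 Cmult.
Definition hCdiv (U : extension) : hcomplex U -> hcomplex U -> hcomplex U :=
  ext2 Cdiv.
Definition hCmod (U : extension) : hcomplex U -> hreal U := ext1 Cmod.

Definition Cexp (z : C) : C :=
  (exp (Re z) * cos (Im z), exp (Re z) * sin (Im z))%R.
Definition hCexp (U : extension) : hcomplex U -> hcomplex U := ext1 Cexp.

Declare Scope hreal_scope.
Delimit Scope hreal_scope with hR.
Bind Scope hreal_scope with hreal.
Notation "x + y" := (hadd x y) : hreal_scope.
Notation "- x" := (hopp x) : hreal_scope.
Notation "x * y" := (hmul x y) : hreal_scope.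
Notation "x / y" := (hdiv x y) : hreal_scope.
Notation "x < y" := (hlt x y) : hreal_scope.
Notation "x <= y" := (hle x y) : hreal_scope.
Notation "0" := (std _ (IZR Z0)) : hreal_scope.

Declare Scope hcomplex_scope.
Delimit Scope hcomplex_scope with hC.
Bind Scope hcomplex_scope with hcomplex.
Notation "x + y" := (hCadd x y) : hcomplex_scope.
Notation "x - y" := (hCsub x y) : hcomplex_scope.
Notation "x * y" := (hCmul x y) : hcomplex_scope.
Notation "x / y" := (hCdiv x y) : hcomplex_scope.
Notation "0" := (std _ (RtoC (IZR Z0))) : hcomplex_scope.
Notation "1" := (std _ (RtoC (IZR (Zpos xH)))) : hcomplex_scope.

Definition pos_infinitesimal (U : extension) (x : hreal U) : Prop :=
  (0 < x)%hR /\ forall r : R, (0 < r)%R -> (x < std U r)%hR.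

Definition infinitesimal (U : extension) (z : hcomplex U) : Prop :=
  z = 0%hC \/ pos_infinitesimal (hCmod z).

Definition infinitely_close (U : extension) (z w : hcomplex U) : Prop :=
  infinitesimal (z - w)%hC.

Definition adequal (U : extension) (z w : hcomplex U) : Prop :=
  (z = 0%hC /\ w = 0%hC) \/ (w <> 0%hC /\ infinitely_close (z / w)%hC 1%hC).

(** * Prevector fields and walks *)

Definition prevector_field (U : extension) : Type := star U (C -> C).

Definition displacement (U : extension) (F : prevector_field U)
    (z : hcomplex U) : hcomplex U := (app F z - z)%hC.

Definition same_adequality_class (U : extension) (F G : prevector_field U) :
    Prop :=
  forall z : hcomplex U, infinitesimal z ->
    adequal (displacement F z) (displacement G z).

Definition internal_iter (U : extension) (N : hnat U) (F : prevector_field U) :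
    prevector_field U := ext2 (fun n (f : C -> C) z => Nat.iter n f z) N F.

Definition hypermultiple (U : extension) (lam t : hreal U) : Prop :=
  exists N : hnat U, t = (hINR N * lam)%hR.

(** The [N] with [t = N lam], which is unique for [lam] nonzero; an arbitrary
    value if [t] is not a hypernatural multiple of [lam]. *)
Definition steps (U : extension) (lam t : hreal U) : hnat U :=
  epsilon (inhabits (std U 0%nat)) (fun N => t = (hINR N * lam)%hR).

Definition walk (U : extension) (lam : hreal U) (F : prevector_field U)
    (t : hreal U) (z : hcomplex U) : hcomplex U :=
  app (internal_iter (steps lam t) F) z.

Definition repeats_after (U : extension) (lam : hreal U)
    (F : prevector_field U) (a : hcomplex U) (T : hreal U) : Prop :=
  forall t : hreal U, hypermultiple lam t ->
    walk lam F (t + T)%hR a = walk lam F t a.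

Definition periodic_with_period (U : extension) (lam : hreal U)
    (F : prevector_field U) (a : hcomplex U) (T : hreal U) : Prop :=
  hypermultiple lam T /\ (0 < T)%hR /\ repeats_after lam F a T /\
  forall S : hreal U,
    hypermultiple lam S -> (0 < S)%hR -> repeats_after lam F a S ->
    (T <= S)%hR.

(* Main.v *)
(** At an infinitesimal [z = x + i y] both displacements are
    [lam omega (y - i x)] up to terms of relative size [O(lam + |z|)], because
    [exp (- i mu) - 1] is close to [- i mu] and [sin x] to [x]; transferring
    this estimate in its epsilon-delta form gives adequality.  The iterates of
    [H] are rotations, [H_t a = exp (- i t omega) a], so [H_t a] first
    returns to [a] when [t omega = 2 pi]. *)

From Stdlib Require Import Reals Lra Classical ClassicalEpsilon.
From Coquelicot Require Import Coquelicot.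
Require Import Defs.

(** * Estimates for sine and cosine *)

(** On [[0, 1]], [sin] lies between its Taylor polynomial [y - y ^ 3 / 6] and [y]; oddness gives the
    negative side. *)
Lemma sin_cubic_bound (x : R) :
  (Rabs x <= 1)%R -> (Rabs (sin x - x) <= Rabs x * x ^ 2 / 6)%R.
Proof.
  assert (Hpos : forall y, (0 <= y <= 1)%R ->
            (Rabs (sin y - y) <= y * y ^ 2 / 6)%R).
  { intros y Hy.
    destruct (pre_sin_bound y 0) as [Hlow _]; [lra | lra |].
    unfold sin_approx, sin_term in Hlow; simpl in Hlow.
    assert (Hup : (sin y <= y)%R).
    { destruct (Req_dec y 0) as [-> | Hy0]; [rewrite sin_0; lra |].
      left; apply sin_lt_x; lra. }
    rewrite Rabs_left1 by lra. simpl. lra. }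
  intros Hx; destruct (Rle_dec 0 x) as [H0 | H0].
  - rewrite (Rabs_pos_eq x) in * by lra. apply Hpos; lra.
  - rewrite (Rabs_left x) in * by lra.
    specialize (Hpos (- x)%R ltac:(lra)). rewrite sin_neg in Hpos.
    rewrite <- Rabs_Ropp.
    replace (- (sin x - x))%R with (- sin x - - x)%R by ring.
    replace (x ^ 2)%R with ((- x) ^ 2)%R by ring. exact Hpos.
Qed.

(** Half-angle formula: [cos x - 1 = - 2 * sin (x / 2) ^ 2], and [sin] is bounded by its argument in
    absolute value. *)
Lemma cos_quadratic_bound (x : R) : (Rabs (cos x - 1) <= x ^ 2 / 2)%R.
Proof.
  assert (Hsin : (Rabs (sin (x / 2)) <= Rabs (x / 2))%R).
  { destruct (Rtotal_order (x / 2) 0) as [H | [H | H]].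
    - rewrite <- (Rabs_Ropp (x / 2)), <- (Rabs_Ropp (sin _)), <- sin_neg.
      apply Rabs_le; rewrite (Rabs_pos_eq (- (x / 2))) by lra.
      pose proof (sin_lt_x (- (x / 2)) ltac:(lra)).
      (* Only the lower bound is left: up to 1 the sine is nonnegative, and beyond 1 the bound -1
         suffices. *)
      destruct (Rle_dec (- (x / 2)) 1).
      + pose proof (sin_ge_0 (- (x / 2)) ltac:(lra) ltac:(pose proof PI2_1; lra)).
        lra.
      + pose proof (SIN_bound (- (x / 2))). lra.
    - rewrite H, sin_0; lra.
    - apply Rabs_le; rewrite (Rabs_pos_eq (x / 2)) by lra.
      pose proof (sin_lt_x (x / 2) ltac:(lra)).
      destruct (Rle_dec (x / 2) 1).
      + pose proof (sin_ge_0 (x / 2) ltac:(lra) ltac:(pose proof PI2_1; lra)).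
        lra.
      + pose proof (SIN_bound (x / 2)). lra. }
  apply Rsqr_le_abs_1 in Hsin; unfold Rsqr in Hsin.
  replace x with (2 * (x / 2))%R at 1 by field.
  rewrite cos_2a_sin. rewrite Rabs_left1 by nra. nra.
Qed.

Lemma Cmod_le_Rabs (z : C) : (Cmod z <= Rabs (fst z) + Rabs (snd z))%R.
Proof.
  pose proof (Rabs_pos (fst z)); pose proof (Rabs_pos (snd z)).
  unfold Cmod. rewrite <- (sqrt_pow2 (Rabs (fst z) + Rabs (snd z))) by lra.
  apply sqrt_le_1_alt.
  pose proof (pow2_abs (fst z)); pose proof (pow2_abs (snd z)). nra.
Qed.

(** * Comparison of the rotation and pendulum displacements *)

Definition rotation (theta : R) (z : C) : C := Cmult (Cexp (0, - theta)%R) z.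

(** Here [mu] stands for [lam * omega]; to first order in [z] this is [- i mu z]. *)
Definition pendulum_displacement (mu : R) (z : C) : C :=
  (mu * snd z, - (mu * sin (fst z)))%R.

Lemma Cexp_imag (theta : R) : Cexp (0, theta)%R = (cos theta, sin theta).
Proof. unfold Cexp; simpl. now rewrite exp_0, !Rmult_1_l. Qed.

(** Since [Rabs (sin x) >= Rabs x / 2] for [Rabs x <= 1], each component is at least half of its
    linear counterpart. This bounds the denominator of the displacement ratio from below. *)
Lemma pendulum_displacement_lower_bound (mu : R) (z : C) :
  (0 < mu)%R -> (Cmod z <= 1)%R ->
  (mu / 2 * Cmod z <= Cmod (pendulum_displacement mu z))%R.
Proof.
  intros Hmu Hz.
  pose proof (Rmax_Cmod z) as Hmax.
  pose proof (Rmax_l (Rabs (fst z)) (Rabs (snd z))).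
  (* The left side becomes the modulus of one product, so that two square roots are compared. *)
  rewrite <- (Rabs_pos_eq (mu / 2)) by lra.
  rewrite <- Cmod_R, <- Cmod_mult.
  destruct z as [x y]; simpl in *.
  pose proof (sin_cubic_bound x ltac:(lra)) as Hs.
  pose proof (Rabs_pos x).
  assert (Hs' : (Rabs (sin x - x) <= Rabs x / 2)%R).
  { eapply Rle_trans; [exact Hs |]. rewrite <- (pow2_abs x). nra. }
  assert (Hx : (Rabs x / 2 <= Rabs (sin x))%R).
  { pose proof (Rabs_triang_inv x (sin x)).
    rewrite <- Rabs_Ropp in Hs'.
    replace (- (sin x - x))%R with (x - sin x)%R in Hs' by ring. lra. }
  assert (Hsq : (x ^ 2 / 4 <= sin x ^ 2)%R).
  { rewrite <- (pow2_abs x), <- (pow2_abs (sin x)). nra. }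
  unfold Cmod, pendulum_displacement; simpl. apply sqrt_le_1_alt.
  assert (0 <= mu ^ 2 * (sin x ^ 2 - x ^ 2 / 4))%R by nra.
  assert (0 <= mu ^ 2 * y ^ 2)%R by nra.
  nra.
Qed.

(** With [c = cos mu - 1], [s = sin mu - mu] and [e = sin x - x], the components of the error are
    [c x + s y] and [c y - s x + mu e]. Four terms are at most [mu ^ 2 * Cmod z], and the last is at
    most [mu * Cmod z ^ 2]. *)
Lemma rotation_displacement_error (mu : R) (z : C) :
  (0 < mu <= 1)%R -> (Cmod z <= 1)%R ->
  (Cmod (rotation mu z - z - pendulum_displacement mu z)%C
     <= mu * Cmod z * (4 * mu + Cmod z))%R.
Proof.
  intros Hmu Hz.
  pose proof (Rmax_Cmod z) as Hmax.
  pose proof (Rmax_l (Rabs (fst z)) (Rabs (snd z))).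
  pose proof (Rmax_r (Rabs (fst z)) (Rabs (snd z))).
  eapply Rle_trans; [apply Cmod_le_Rabs |].
  unfold rotation, pendulum_displacement. rewrite Cexp_imag, cos_neg, sin_neg.
  destruct z as [x y]; simpl in *.
  set (m := Cmod (x, y)) in *.
  pose proof (cos_quadratic_bound mu) as Hc.
  pose proof (sin_cubic_bound mu ltac:(rewrite Rabs_pos_eq; lra)) as Hs.
  rewrite (Rabs_pos_eq mu) in Hs by lra.
  pose proof (sin_cubic_bound x ltac:(lra)) as Hx.
  set (c := (cos mu - 1)%R) in *. set (s := (sin mu - mu)%R) in *.
  set (e := (sin x - x)%R) in *.
  pose proof (Rabs_pos x); pose proof (Rabs_pos y).
  pose proof (Rabs_pos c); pose proof (Rabs_pos s).
  assert (Hs' : (Rabs s <= mu ^ 2)%R) by nra.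
  assert (Hc' : (Rabs c <= mu ^ 2)%R) by nra.
  assert (He : (Rabs e <= m ^ 2)%R).
  { eapply Rle_trans; [exact Hx |]. rewrite <- (pow2_abs x). nra. }
  assert (Hprod : forall u v, (Rabs u <= mu ^ 2)%R -> (Rabs v <= m)%R ->
            (Rabs (u * v) <= mu ^ 2 * m)%R).
  { intros u v Hu Hv. rewrite Rabs_mult.
    apply Rmult_le_compat; auto using Rabs_pos. }
  pose proof (Hprod c x Hc' ltac:(lra)). pose proof (Hprod c y Hc' ltac:(lra)).
  pose proof (Hprod s x Hs' ltac:(lra)). pose proof (Hprod s y Hs' ltac:(lra)).
  assert (Hme : (Rabs (mu * e) <= mu * m ^ 2)%R).
  { rewrite Rabs_mult, (Rabs_pos_eq mu) by lra. nra. }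
  match goal with |- (Rabs ?A + Rabs ?B <= _)%R =>
    replace A with (c * x + s * y)%R by (unfold c, s; ring);
    replace B with (c * y + - (s * x) + mu * e)%R by (unfold c, s, e; ring)
  end.
  pose proof (Rabs_triang (c * x) (s * y)).
  pose proof (Rabs_triang (c * y + - (s * x)) (mu * e)).
  pose proof (Rabs_triang (c * y) (- (s * x))).
  rewrite (Rabs_Ropp (s * x)) in *.
  nra.
Qed.

(** Dividing the error estimate by the lower bound leaves a relative error of at most
    [8 * mu + 2 * Cmod z]. *)
Lemma displacement_ratio_close (omega eps : R) :
  (0 < omega)%R -> (0 < eps)%R ->
  exists delta : R, (0 < delta)%R /\
    forall (lam : R) (z : C),
      (0 < lam)%R -> (lam < delta)%R -> (0 < Cmod z)%R -> (Cmod z < delta)%R ->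
      pendulum_displacement (lam * omega) z <> RtoC 0 /\
      (Cmod ((rotation (lam * omega) z - z)
               / pendulum_displacement (lam * omega) z - 1)%C < eps)%R.
Proof.
  intros Hw He.
  assert (Hk : (0 < 1 + 8 * omega + 2)%R) by lra.
  (* This makes [(8 * omega + 2) * delta] less than [eps]; the minimum with 1 keeps [mu] and
     [Cmod z] at most 1, the range of both estimates. *)
  exists (Rmin 1 eps / (1 + 8 * omega + 2))%R.
  pose proof (Rmin_l 1 eps); pose proof (Rmin_r 1 eps).
  assert (Hmin : (0 < Rmin 1 eps)%R) by (apply Rmin_glb_lt; lra).
  set (d := (Rmin 1 eps / (1 + 8 * omega + 2))%R).
  assert (Hd : (d * (1 + 8 * omega + 2) = Rmin 1 eps)%R)
    by (unfold d; field; lra).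
  assert (Hd0 : (0 < d)%R) by (apply Rdiv_lt_0_compat; lra).
  split; [exact Hd0 |].
  intros lam z Hl Hld Hz Hzd.
  set (mu := (lam * omega)%R).
  assert (Hmu : (0 < mu)%R) by (unfold mu; nra).
  assert (Hmud : (mu <= d * omega)%R) by (unfold mu; nra).
  assert (Hmu1 : (mu <= 1)%R) by nra.
  assert (Hz1 : (Cmod z <= 1)%R) by nra.
  pose proof (pendulum_displacement_lower_bound mu z Hmu Hz1) as Hlow.
  pose proof (rotation_displacement_error mu z ltac:(lra) Hz1) as Herr.
  set (D := pendulum_displacement mu z) in *.
  assert (HD0 : (0 < Cmod D)%R) by nra.
  assert (HD : D <> RtoC 0) by (apply Cmod_gt_0; exact HD0).
  split; [exact HD |].
  replace ((rotation mu z - z) / D - 1)%C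
    with ((rotation mu z - z - D) / D)%C by (field; exact HD).
  rewrite Cmod_div by exact HD.
  apply (Rmult_lt_reg_r (Cmod D)); [exact HD0 |].
  unfold Rdiv; rewrite Rmult_assoc, Rinv_l by lra.
  assert (Hsmall : (8 * mu + 2 * Cmod z < eps)%R) by nra.
  assert (Hpos : (0 < mu * Cmod z)%R) by nra.
  nra.
Qed.

(** * Iterated rotations *)

(** Angles add under composition. The map [h] is given by its values only, which is how a
    first-order formula describes an internal function. *)
Lemma rotation_iter (theta : R) (h : C -> C) :
  (forall z, h z = rotation theta z) ->
  forall (n : nat) (z : C), Nat.iter n h z = rotation (INR n * theta) z.
Proof.
  intros Hh n z; induction n as [| n IH].
  - simpl. unfold rotation. rewrite Cexp_imag, Rmult_0_l, Ropp_0, cos_0, sin_0.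
    symmetry; apply Cmult_1_l.
  - rewrite S_INR. simpl Nat.iter. rewrite IH, Hh. unfold rotation.
    rewrite !Cexp_imag.
    replace (- ((INR n + 1) * theta))%R
      with (- theta + - (INR n * theta))%R by ring.
    rewrite cos_plus, sin_plus, Cmult_assoc. f_equal.
    unfold Cmult; simpl; f_equal; ring.
Qed.

Lemma rotation_periodic (theta : R) (z : C) :
  rotation (theta + 2 * PI) z = rotation theta z.
Proof.
  unfold rotation. rewrite !Cexp_imag, !cos_neg, !sin_neg, cos_plus, sin_plus.
  rewrite cos_2PI, sin_2PI. f_equal; f_equal; ring.
Qed.

(** Cancelling [z] gives [cos theta = 1], whereas [cos theta = 1 - 2 * sin (theta / 2) ^ 2 < 1] for
    [theta] strictly between 0 and [2 * PI]. *)
Lemma rotation_return (theta : R) (z : C) :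
  (0 < theta)%R -> z <> RtoC 0 -> rotation theta z = rotation 0 z ->
  (2 * PI <= theta)%R.
Proof.
  intros Ht Hz. unfold rotation. rewrite !Cexp_imag, !cos_neg, Ropp_0, sin_0, cos_0.
  intros H.
  assert (Hcos : cos theta = 1%R).
  { assert (Heq : (cos theta, sin (- theta)) = RtoC 1).
    { rewrite <- (Cmult_1_r (_, _)), <- (Cinv_r z Hz), Cmult_assoc, H.
      rewrite <- Cmult_assoc, Cinv_r by exact Hz. apply Cmult_1_r. }
    now injection Heq. }
  destruct (Rle_dec (2 * PI) theta) as [| Hlt]; [assumption | exfalso].
  replace theta with (2 * (theta / 2))%R in Hcos by field.
  rewrite cos_2a_sin in Hcos.
  pose proof (sin_gt_0 (theta / 2) ltac:(lra) ltac:(lra)). nra.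
Qed.

(** * Transfer *)

(* A goal about [U] is convertible to the reading in [U] of an explicit formula,
   which [refine (proj1 (transfer U phi) _)] trades for its standard reading. *)

Notation App2 f t u := (App (fun p => f (fst p) (snd p)) (Pair t u)).
Notation FRel2 P t u := (FPred (fun p => P (fst p) (snd p)) (Pair t u)).
Notation v0 := (Var (VZ _ _)).
Notation v1 := (Var (VS _ (VZ _ _))).
Notation v2 := (Var (VS _ (VS _ (VZ _ _)))).
Notation v3 := (Var (VS _ (VS _ (VS _ (VZ _ _))))).
Notation v4 := (Var (VS _ (VS _ (VS _ (VS _ (VZ _ _)))))).

(** Formula counterparts of [app], [hrotation], [displacement] and the pendulum field, shaped so
    that their readings in [U] are convertible to these. *)
Notation TApp f z := (App2 (fun (k : C -> C) u => k u) f z).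
Notation TRotation theta z :=
  (App2 Cmult (App Cexp (Pair (Cst _ 0%R) (App Ropp theta))) z).
Notation TDisplacement f z := (App2 Cminus (TApp f z) z).
Notation TPendulum lam omega x y :=
  (App2 Cplus (Pair x y)
     (Pair (App2 Rmult (App2 Rmult lam (Cst _ omega)) y)
        (App Ropp (App2 Rmult (App2 Rmult lam (Cst _ omega)) (App sin x))))).

Section Transfer.

Variable U : extension.

(** Spelled out by hypercomplex operations, to be convertible to the formula for [H] in the
    theorem. *)
Definition hrotation (theta : hreal U) (z : hcomplex U) : hcomplex U :=
  (hCexp (hC 0 (- theta)) * z)%hC.

Lemma hCmod_pos (w : hcomplex U) : w <> 0%hC -> (0 < hCmod w)%hR.
Proof.
  revert w.
  refine (proj1 (transfer U
    (FAll (X := C) (FImp (FImp (FEq v0 (Cst _ (RtoC 0))) (FBot _))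
       (FRel2 Rlt (Cst _ 0%R) (App Cmod v0))))) _).
  intros w; simpl; apply Cmod_gt_0.
Qed.

Lemma std_pos (r : R) : (0 < r)%R -> (0 < std U r)%hR.
Proof.
  exact (proj1 (transfer U (FRel2 Rlt (Cst _ 0%R) (Cst _ r)))).
Qed.

Lemma hypermultiple_0 (lam : hreal U) : hypermultiple lam 0%hR.
Proof.
  exists (std U 0%nat); revert lam.
  refine (proj1 (transfer U
    (FAll (X := R) (FEq (Cst _ 0%R)
       (App2 Rmult (App INR (Cst _ 0%nat)) v0)))) _).
  intros lam; simpl; ring.
Qed.

Lemma hypermultiple_add (lam s t : hreal U) :
  hypermultiple lam s -> hypermultiple lam t -> hypermultiple lam (s + t)%hR.
Proof.
  intros [M ->] [N ->]; revert lam M N.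
  refine (proj1 (transfer U
    (FAll (X := R) (FAll (X := nat) (FAll (X := nat) (FEx (X := nat)
       (FEq (App2 Rplus (App2 Rmult (App INR v2) v3)
                        (App2 Rmult (App INR v1) v3))
            (App2 Rmult (App INR v0) v3))))))) _).
  intros lam M N; exists (M + N)%nat; simpl; rewrite plus_INR; ring.
Qed.

Lemma hypermultiple_of_quotient (T : R) (lam : hreal U) (N : hnat U) :
  (0 < lam)%hR -> (std U T / lam)%hR = hINR N -> hypermultiple lam (std U T).
Proof.
  intros Hlam HN; exists N; revert lam N Hlam HN.
  refine (proj1 (transfer U
    (FAll (X := R) (FAll (X := nat)
       (FImp (FRel2 Rlt (Cst _ 0%R) v1)
       (FImp (FEq (App2 Rdiv (Cst _ T) v1) (App INR v0))
          (FEq (Cst _ T) (App2 Rmult (App INR v0) v1))))))) _).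
  intros lam N; simpl; intros Hlam <-; field; lra.
Qed.

(** * The rotation prevector field and its walk *)

(** Transferring an existential over [C -> C] yields an internal function, hence a prevector field,
    even for nonstandard [lam]. *)
Lemma rotation_field_exists (omega : R) (lam : hreal U) :
  exists H : prevector_field U,
    forall z, app H z = hrotation (lam * std U omega)%hR z.
Proof.
  revert lam.
  refine (proj1 (transfer U
    (FAll (X := R) (FEx (X := C -> C) (FAll (X := C)
       (FEq (TApp v1 v0)
            (TRotation (App2 Rmult v2 (Cst _ omega)) v0)))))) _).
  intros lam; exists (rotation (lam * omega)); intros z; reflexivity.
Qed.

(** [N] may be infinite, so induction is carried out on standard naturals in [rotation_iter] and the
    result is transferred. *)
Lemma app_internal_iter_rotation (omega : R) (lam : hreal U)
    (H : prevector_field U) :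
  (forall z, app H z = hrotation (lam * std U omega)%hR z) ->
  forall (N : hnat U) (z : hcomplex U),
    app (internal_iter N H) z = hrotation (hINR N * lam * std U omega)%hR z.
Proof.
  revert lam H.
  refine (proj1 (transfer U
    (FAll (X := R) (FAll (X := C -> C)
       (FImp
          (FAll (X := C)
             (FEq (TApp v1 v0)
                  (TRotation (App2 Rmult v2 (Cst _ omega)) v0)))
          (FAll (X := nat) (FAll (X := C)
             (FEq (TApp (App2 (fun n (f : C -> C) z => Nat.iter n f z) v1 v2)
                        v0)
                  (TRotation
                     (App2 Rmult (App2 Rmult (App INR v1) v3) (Cst _ omega))
                     v0)))))))) _).
  intros lam h; simpl; intros Hh N z.
  rewrite Rmult_assoc; exact (rotation_iter _ h Hh N z).
Qed.

Lemma walk_rotation (omega : R) (lam : hreal U) (H : prevector_field U)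
    (t : hreal U) (z : hcomplex U) :
  (forall z, app H z = hrotation (lam * std U omega)%hR z) ->
  hypermultiple lam t ->
  walk lam H t z = hrotation (t * std U omega)%hR z.
Proof.
  intros HH Ht; unfold walk, steps.
  rewrite (app_internal_iter_rotation _ _ _ HH).
  apply (f_equal (fun s => hrotation (s * std U omega)%hR z)).
  (* As [t] is a hypermultiple, the chosen [N] does satisfy [t = N lam]. *)
  symmetry; exact (epsilon_spec (inhabits (std U 0%nat)) _ Ht).
Qed.

Lemma hrotation_periodic (omega T : R) (t : hreal U) (z : hcomplex U) :
  (T * omega = 2 * PI)%R ->
  hrotation ((t + std U T) * std U omega)%hR z =
  hrotation (t * std U omega)%hR z.
Proof.
  intros HT; revert t z.
  refine (proj1 (transfer U
    (FAll (X := R) (FAll (X := C)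
       (FEq (TRotation
               (App2 Rmult (App2 Rplus v1 (Cst _ T)) (Cst _ omega)) v0)
            (TRotation (App2 Rmult v1 (Cst _ omega)) v0))))) _).
  intros t z; simpl; rewrite Rmult_plus_distr_r, HT.
  exact (rotation_periodic _ z).
Qed.

(** Transfer of [rotation_return] at angle [S * omega]. The terms [0 + S] and [0] are the times of
    the walk compared at [t = 0]. *)
Lemma hrotation_return (omega T : R) (a S : hreal U) :
  (0 < omega)%R -> (T * omega = 2 * PI)%R ->
  (0 < a)%hR -> (0 < S)%hR ->
  hrotation ((0 + S) * std U omega)%hR (hC a 0) =
  hrotation (0 * std U omega)%hR (hC a 0) ->
  (std U T <= S)%hR.
Proof.
  intros Hw HT; revert a S.
  refine (proj1 (transfer U
    (FAll (X := R) (FAll (X := R)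
       (FImp (FRel2 Rlt (Cst _ 0%R) v1)
       (FImp (FRel2 Rlt (Cst _ 0%R) v0)
       (FImp
          (FEq (TRotation
                  (App2 Rmult (App2 Rplus (Cst _ 0%R) v0) (Cst _ omega))
                  (Pair v1 (Cst _ 0%R)))
               (TRotation (App2 Rmult (Cst _ 0%R) (Cst _ omega))
                  (Pair v1 (Cst _ 0%R))))
          (FRel2 Rle (Cst _ T) v0))))))) _).
  intros a S; simpl; intros Ha HS; rewrite Rplus_0_l, Rmult_0_l; intros Hrot.
  apply (Rmult_le_reg_r omega); [exact Hw |]; rewrite HT.
  apply (rotation_return _ (a, 0%R)).
  - now apply Rmult_lt_0_compat.
  - intros Heq; injection Heq; lra.
  - exact Hrot.
Qed.

Lemma rotation_walk_period (omega T : R) (lam : hreal U)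
    (H : prevector_field U) (a : hreal U) :
  (0 < omega)%R -> (T * omega = 2 * PI)%R ->
  hypermultiple lam (std U T) ->
  (forall z, app H z = hrotation (lam * std U omega)%hR z) ->
  (0 < a)%hR ->
  periodic_with_period lam H (hC a 0) (std U T).
Proof.
  intros Hw HT Hmul HH Ha; repeat split.
  - exact Hmul.
  - apply std_pos. pose proof PI_RGT_0. nra.
  - intros t Ht.
    rewrite !(walk_rotation omega) by auto using hypermultiple_add.
    now apply hrotation_periodic.
  - intros S HS HS0 Hrep.
    (* Minimality follows from the return at [t = 0] alone: rotation by [S * omega] must fix the
       nonzero [a]. *)
    specialize (Hrep _ (hypermultiple_0 lam)).
    rewrite !(walk_rotation omega) in Hrep
      by auto using hypermultiple_add, hypermultiple_0.
    now apply (hrotation_return omega T a S).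
Qed.

(** * Adequality of the two displacements *)

Section Adequality.

Variables (omega : R) (lam : hreal U) (F H : prevector_field U).

Hypothesis F_pendulum : forall x y : hreal U,
  app F (hC x y) =
    (hC x y
     + hC (lam * std U omega * y) (- (lam * std U omega * hsin x)))%hC.

Hypothesis H_rotation : forall z : hcomplex U,
  app H z = hrotation (lam * std U omega)%hR z.

(** Both fields fix the origin; this is the case of adequality that is not stated by a ratio. *)
Lemma displacement_0 :
  displacement H 0%hC = 0%hC /\ displacement F 0%hC = 0%hC.
Proof.
  revert lam F H F_pendulum H_rotation.
  refine (proj1 (transfer U
    (FAll (X := R) (FAll (X := C -> C) (FAll (X := C -> C)
       (FImp
          (FAll (X := R) (FAll (X := R)
             (FEq (TApp v3 (Pair v1 v0)) (TPendulum v4 omega v1 v0))))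
       (FImp
          (FAll (X := C)
             (FEq (TApp v1 v0)
                  (TRotation (App2 Rmult v3 (Cst _ omega)) v0)))
          (FAnd
             (FEq (TDisplacement v0 (Cst _ (RtoC 0))) (Cst _ (RtoC 0)))
             (FEq (TDisplacement v1 (Cst _ (RtoC 0)))
                  (Cst _ (RtoC 0)))))))))) _).
  intros lam' f h; simpl; intros Hf Hh; split.
  - rewrite Hh; ring.
  (* Unfolding exhibits 0 as a pair, the form in which [Hf] describes the field. *)
  - unfold RtoC; rewrite Hf, sin_0. apply injective_projections; simpl; ring.
Qed.

(** Transfers the estimate for one fixed standard pair [eps], [delta], with the defining equations
    of [F] and [H] as premises of the transferred formula. *)
Lemma displacement_ratio_lt (eps delta : R) :
  (forall (mu : R) (z : C),
     (0 < mu)%R -> (mu < delta)%R -> (0 < Cmod z)%R -> (Cmod z < delta)%R ->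
     pendulum_displacement (mu * omega) z <> RtoC 0 /\
     (Cmod ((rotation (mu * omega) z - z)
              / pendulum_displacement (mu * omega) z - 1)%C < eps)%R) ->
  (0 < lam)%hR -> (lam < std U delta)%hR ->
  forall z : hcomplex U, (0 < hCmod z)%hR -> (hCmod z < std U delta)%hR ->
    displacement F z <> 0%hC /\
    (hCmod (displacement H z / displacement F z - 1)%hC < std U eps)%hR.
Proof.
  intros Hstd; revert lam F H F_pendulum H_rotation.
  refine (proj1 (transfer U
    (FAll (X := R) (FAll (X := C -> C) (FAll (X := C -> C)
       (FImp
          (FAll (X := R) (FAll (X := R)
             (FEq (TApp v3 (Pair v1 v0)) (TPendulum v4 omega v1 v0))))
       (FImp
          (FAll (X := C)
             (FEq (TApp v1 v0)
                  (TRotation (App2 Rmult v3 (Cst _ omega)) v0)))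
       (FImp (FRel2 Rlt (Cst _ 0%R) v2)
       (FImp (FRel2 Rlt v2 (Cst _ delta))
          (FAll (X := C)
             (FImp (FRel2 Rlt (Cst _ 0%R) (App Cmod v0))
             (FImp (FRel2 Rlt (App Cmod v0) (Cst _ delta))
                (FAnd
                   (FImp (FEq (TDisplacement v2 v0) (Cst _ (RtoC 0)))
                         (FBot _))
                   (FRel2 Rlt
                      (App Cmod
                         (App2 Cminus
                            (App2 Cdiv (TDisplacement v1 v0)
                                       (TDisplacement v2 v0))
                            (Cst _ (RtoC 1))))
                      (Cst _ eps)))))))))))))) _).
  intros mu f h; simpl; intros Hf Hh Hmu Hmud z Hz Hzd.
  assert (Hdisp : (f z - z)%C = pendulum_displacement (mu * omega) z).
  { rewrite (surjective_pairing z) at 1 2; rewrite Hf.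
    apply injective_projections; simpl; ring. }
  rewrite Hdisp, Hh; exact (Hstd mu z Hmu Hmud Hz Hzd).
Qed.

(** Infinitesimal [lam] and [hCmod z] lie below every standard [delta], so the ratio differs from 1
    by less than every standard [eps]. *)
Lemma rotation_adequal_pendulum :
  (0 < omega)%R -> pos_infinitesimal lam -> same_adequality_class H F.
Proof.
  intros Hw [Hlam Hlam'] z [-> | [Hz Hz']].
  { left; exact displacement_0. }
  assert (Hratio : forall eps, (0 < eps)%R ->
    displacement F z <> 0%hC /\
    (hCmod (displacement H z / displacement F z - 1)%hC < std U eps)%hR).
  { intros eps Heps.
    destruct (displacement_ratio_close omega eps Hw Heps)
      as [delta [Hdelta Hstd]].
    now apply (displacement_ratio_lt eps delta Hstd); auto. }
  right; split; [exact (proj1 (Hratio 1%R Rlt_0_1)) |].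
  (* Being infinitesimal means being exactly 0 or having a positive infinitesimal modulus. *)
  destruct (classic
    ((displacement H z / displacement F z - 1)%hC = 0%hC)) as [H0 | H0].
  - now left.
  - right; split; [now apply hCmod_pos |].
    intros r Hr; exact (proj2 (Hratio r Hr)).
Qed.

End Adequality.

End Transfer.

(** * The period of infinitesimal oscillations *)

Theorem corollary6p1 :
  forall (U : extension) (g l : R) (lam : hreal U),
    (0 < g)%R -> (0 < l)%R ->
    let omega : R := sqrt (g / l) in
    let T : R := (2 * PI / omega)%R in
    pos_infinitesimal lam ->
    (exists N : hnat U, (std U T / lam)%hR = hINR N) ->
    forall F : prevector_field U,
      (forall x y : hreal U,
         app F (hC x y) =
           (hC x y + hC (lam * std U omega * y) (- (lam * std U omega * hsin x)))%hC) ->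
      T = (2 * PI * sqrt (l / g))%R /\
      exists H : prevector_field U,
        (forall z : hcomplex U,
           app H z = (hCexp (hC 0 (- (lam * std U omega))) * z)%hC) /\
        same_adequality_class H F /\
        (forall a : hreal U, pos_infinitesimal a ->
           periodic_with_period lam H (hC a 0) (std U T)).
Proof.
  intros U g l lam Hg Hl omega T Hlam [N HN] F HF.
  assert (Hw : (0 < omega)%R) by now apply sqrt_lt_R0, Rdiv_lt_0_compat.
  split.
  { unfold T, Rdiv at 1; f_equal.
    (* The inverse of [sqrt (g / l)] is [sqrt (l / g)]. *)
    unfold omega; rewrite <- sqrt_inv; f_equal; field; lra. }
  destruct (rotation_field_exists U omega lam) as [H HH].
  exists H; split; [exact HH |]; split.
  - now apply (rotation_adequal_pendulum U omega lam F H HF HH).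
  - intros a [Ha _].
    apply (rotation_walk_period U omega T lam H a); auto.
    + unfold T; field; lra.
    + exact (hypermultiple_of_quotient U T lam N (proj1 Hlam) HN).
Qed.
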